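(* Let $f(\mathbf{x})$ be a real-valued sufficiently smooth function defined on $\mathbb{R}^d$, and for $\mathbf{x}=(x_j)\in\mathbb{R}^d$ and $j=1,\dots,d$ let $f_{j,\mathbf{x}}(y)=f\big(\mathbf{x}+(y-x_j)e_j\big)$, $y\in\mathbb{R}$, where $e_j$ is the $j$-th standard basis vector of $\mathbb{R}^d$. Let $\alpha_k\in(0,1)$, $\beta_k\in\mathbb{R}$, $\mathbf{x}^{(k)}=(x_j^k)\in\mathbb{R}^d$, $\mathbf{c}_k=(c_j^k)\in\mathbb{R}^d$ and $\Delta_j^k=|x_j^k-c_j^k|/2$. Let $\vec{\mathbf{d}}_k$ be the scaled Caputo fractional gradient direction $$\vec{\mathbf{d}}_k = \mathrm{diag}\big({}_{c_j^k}^{C}D^{\alpha_k}_{x} I(x^k_j)\big)^{-1}\Big[ {}_{\mathbf{c}_k}^{C}\nabla^{\alpha_k}_{\mathbf{x}} f(\mathbf{x}^{(k)})+\beta_k\, \mathrm{diag}\big(|x^k_j-c^k_j|\big)\; {}_{\mathbf{c}_k}^{C}\nabla^{1+\alpha_k}_{\mathbf{x}} f(\mathbf{x}^{(k)})\Big].$$ Then, for $j=1,\dots,d$, $$\big(\vec{\mathbf{d}}_k\big)_j = C_{\alpha_k}\int_{-1}^{1} f_{j,\mathbf{x}^{(k)}}'\big(\Delta_j^k(1+u)+c_j^k\big)(1-u)^{-\alpha_k}\,du + C_{\alpha_k}\,\beta_k\,|x_j^k-c_j^k|\int_{-1}^{1} f_{j,\mathbf{x}^{(k)}}''\big(\Delta_j^k(1+u)+c_j^k\big)(1-u)^{-\alpha_k}\,du,$$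 where $C_{\alpha}=(1-\alpha)2^{-(1-\alpha)}$.
   Context: Caputo fractional derivatives. Let $\nu\in(n-1,n)$ with $n\in\mathbb{N}$, and let $c\in\mathbb{R}$. For $x\ge c$, ${}_{c}^{C}D_x^{\nu} g(x)=\frac{1}{\Gamma(n-\nu)}\int_c^x \frac{g^{(n)}(t)}{(x-t)^{\nu-n+1}}\,dt$ (left Caputo derivative). For $x<c$, the same symbol is understood as the right Caputo derivative ${}_{c}^{C}D_x^{\nu} g(x)=\frac{(-1)^n}{\Gamma(n-\nu)}\int_x^c \frac{g^{(n)}(t)}{(t-x)^{\nu-n+1}}\,dt$. $\Gamma$ is the Gamma function and $I(x)=x$ is the identity map on $\mathbb{R}$. Caputo fractional gradient. For $\mathbf{c}=(c_j)\in\mathbb{R}^d$, ${}_{\mathbf{c}}^{C}\nabla_{\mathbf{x}}^{\nu} f(\mathbf{x})\in\mathbb{R}^d$ is the vector whose $j$-th component is ${}_{c_j}^{C}D_x^{\nu} f_{j,\mathbf{x}}$ evaluated at $x_j$ (the functions $f_{j,\mathbf{x}}$ are assumed to be such that these derivatives exist and are finite). $\mathrm{diag}(v_j)$ is the $d\times d$ diagonal matrix with $(j,j)$ entry $v_j$. The inverse in the definition of $\vec{\mathbf{d}}_k$ presupposes $x_j^k\ne c_j^k$ for all $j$.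
   Formalization: For x_j < c_j the printed identity is false (d=1, f=x²/2, c=0, x=-1, β=0); there Δ is replaced by -Δ in the arguments of f' and f'' and the second term gets a minus sign; for x_j > c_j it is as printed. ''Sufficiently smooth'' is read as C². *)

(* Defs.v *)
From HB Require Import structures.
From mathcomp Require Import all_boot all_order all_algebra.
From mathcomp Require Import all_classical all_reals all_analysis.

Set Implicit Arguments.
Unset Strict Implicit.
Unset Printing Implicit Defensive.

Import Order.TTheory GRing.Theory Num.Theory.
Import numFieldNormedType.Exports.

Local Open Scope ring_scope.
Local Open Scope classical_set_scope.

(* The defining integral converges only for 0 < z. *)
Definition Gamma (R : realType) (z : R) : R :=
  \int[lebesgue_measure]_(t in `]0, +oo[) (t `^ (z - 1) * expR (- t)).

(* The natural number n with n - 1 < nu < n, when nu > 0 is not an integer. *)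
Definition caputo_order (R : realType) (nu : R) : nat := (Num.truncn nu).+1.

(* Left Caputo derivative at x when c <= x, right Caputo derivative when x < c.
   At the singular endpoint t = x the integrand takes a junk value (division
   by zero), on a null set. *)
Definition caputo (R : realType) (nu c : R) (g : R -> R) (x : R) : R :=
  let n := caputo_order nu in
  if c <= x then
    (Gamma (n%:R - nu))^-1 *
    \int[lebesgue_measure]_(t in `[c, x])
      (derive1n n g t / (x - t) `^ (nu - n%:R + 1))
  else
    (-1) ^+ n / Gamma (n%:R - nu) *
    \int[lebesgue_measure]_(t in `[x, c])
      (derive1n n g t / (t - x) `^ (nu - n%:R + 1)).

Definition std_basis (R : realType) (d : nat) (j : 'I_d) : 'cV[R]_d :=
  delta_mx j ord0.

Definition slice (R : realType) (d : nat) (f : 'cV[R]_d -> R) (x : 'cV[R]_d)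
    (j : 'I_d) : R -> R :=
  fun y => f (x + (y - x j ord0) *: std_basis R j).

Fixpoint Ck (R : realType) (d m : nat) (f : 'cV[R]_d -> R) : Prop :=
  if m is m'.+1 then
    [/\ continuous f,
        forall (j : 'I_d) (x : 'cV[R]_d), derivable f x (std_basis R j) &
        forall j : 'I_d, Ck m' (fun x => 'D_(std_basis R j) f x)]
  else continuous f.

Definition caputo_gradient (R : realType) (d : nat) (nu : R) (c : 'cV[R]_d)
    (f : 'cV[R]_d -> R) (x : 'cV[R]_d) : 'cV[R]_d :=
  \col_j caputo nu (c j ord0) (slice f x j) (x j ord0).

(* The matrix inverted here is invertible only if x j != c j for all j. *)
Definition scaled_caputo_direction (R : realType) (d : nat) (alpha beta : R)
    (c : 'cV[R]_d) (f : 'cV[R]_d -> R) (x : 'cV[R]_d) : 'cV[R]_d :=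
  invmx (diag_mx (\row_j caputo alpha (c j ord0) (@id R) (x j ord0))) *m
  (caputo_gradient alpha c f x +
   beta *: (diag_mx (\row_j `|x j ord0 - c j ord0|) *m
            caputo_gradient (1 + alpha) c f x)).

Definition Ccoef (R : realType) (alpha : R) : R :=
  (1 - alpha) * 2 `^ (- (1 - alpha)).

(* Main.v *)
(* The substitution t = c + (x - c) (1 + u) / 2 maps [-1, 1] onto the interval
   between c and x, with x - t = (x - c) (1 - u) / 2. It turns the Caputo
   derivatives of orders alpha and 1 + alpha at x into
   |(x - c) / 2|^(1 - alpha) / Gamma (1 - alpha) times the integrals of
   g' and g'' against (1 - u)^(-alpha), up to the sign of the right derivative.
   For the identity map the integral is 2^(1 - alpha) / (1 - alpha), the inverse
   of C_alpha, so the common factor cancels in the quotient. Cancelling also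
   needs 0 < Gamma (1 - alpha) < +oo, because the real-valued integral defining
   Gamma would be 0 if it diverged. *)

Require Import Defs.
From HB Require Import structures.
From mathcomp Require Import all_boot all_order all_algebra.
From mathcomp Require Import all_classical all_reals all_analysis.
From mathcomp Require Import measurable_realfun ring lra.

Set Implicit Arguments.
Unset Strict Implicit.
Unset Printing Implicit Defensive.

Import Order.TTheory GRing.Theory Num.Theory.
Import numFieldNormedType.Exports.

Local Open Scope ring_scope.
Local Open Scope classical_set_scope.

(** * Affine change of variables for the Lebesgue integral *)

Section affine_substitution.
Context {R : realType}.
Notation mu := (@lebesgue_measure R).
Implicit Types (a b : R) (D : set R).

Lemma continuous_affine a b : continuous (fun u : R => a * u + b).
Proof. move=> u; apply: (@continuousD _ R^o); last exact: cst_continuous.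
by apply: continuousM => //; exact: cst_continuous. Qed.

Lemma measurable_affine a b : measurable_fun [set: R] (fun u => a * u + b).
Proof. by apply: continuous_measurable_fun; apply: continuous_affine. Qed.

(* The measure instance of [pushforward] takes the proof of measurability as an
   argument, which unification cannot find; it is supplied here. *)
Definition pushforward_measure (phi : R -> R)
    (mphi : measurable_fun [set: R] phi) :
    {measure set (measurableTypeR R) -> \bar R} :=
  @measure_function_pushforward__canonical__measure_function_Measure _ _
    (measurableTypeR R) (measurableTypeR R) R mu phi mphi.

Lemma preimage_affine_itvoc a b (p q : R) : 0 < a ->
  (fun u => a * u + b) @^-1` `]p, q] = `](p - b) / a, (q - b) / a]%classic.
Proof.
by move=> a0; apply/seteqP; split=> u /=; rewrite !in_itv/= ltr_pdivrMr//
  ler_pdivlMr// ltrBlDr lerBrDr mulrC.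
Qed.

Lemma preimage_affine_itvoc_neg a b (p q : R) : a < 0 ->
  (fun u => a * u + b) @^-1` `]p, q] = `[(q - b) / a, (p - b) / a[%classic.
Proof.
by move=> a0; apply/seteqP; split=> u /=; rewrite !in_itv/= ltr_ndivlMr//
  ler_ndivrMr// ltrBlDr lerBrDr mulrC andbC.
Qed.

(** By uniqueness of Lebesgue measure it suffices to compare lengths on intervals []p, q]]. A
    negative slope moves the closed endpoint to the left, which leaves the length of the preimage
    unchanged. *)
Lemma lebesgue_measure_affine a b D : a != 0 -> measurable D ->
  mu D = (`|a|%:E * mu ((fun u => a * u + b)%R @^-1` D))%E.
Proof.
move=> a0 mD.
pose nu := pushforward_measure (measurable_affine a b).
apply: (@lebesgue_measure_unique R (mscale `|a|%:nng nu)) => //.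
move=> _ /ocitvP[->|[[p q] /= pq ->]]; first by rewrite !measure0.
rewrite /mscale /= /pushforward; case: (ltgtP a 0) a0 => // a0 _.
- rewrite preimage_affine_itvoc_neg// !lebesgue_measure_itv/= !lte_fin pq.
  rewrite ltr_nM2r ?invr_lt0// ltrBDr subrK pq -!EFinB -EFinM ltr0_norm//.
  by congr EFin; field; rewrite lt_eqF.
- rewrite preimage_affine_itvoc// !lebesgue_measure_itv/= !lte_fin pq.
  rewrite ltr_pM2r ?invr_gt0// ltrBDr subrK pq -!EFinB -EFinM gtr0_norm//.
  by congr EFin; field; rewrite gt_eqF.
Qed.

Lemma ge0_integral_affine a b D (f : R -> \bar R) : a != 0 -> measurable D ->
  measurable_fun D f -> (forall x, D x -> 0 <= f x)%E ->
  (\int[mu]_(t in D) f t =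
   `|a|%:E * \int[mu]_(u in (fun u => a * u + b)%R @^-1` D) f (a * u + b)%R)%E.
Proof.
move=> a0 mD mf f0.
rewrite -(@ge0_integral_pushforward _ _ (measurableTypeR R)
  (measurableTypeR R) _ _ (measurable_affine a b) mu D f)//; last first.
  by move=> x /[!inE]; exact: f0.
pose nu := pushforward_measure (measurable_affine a b).
rewrite -(@ge0_integral_mscale _ _ _ nu D mD `|a|%:nng f)//.
apply: eq_measure_integral => A mA _; exact: lebesgue_measure_affine.
Qed.

(** The nonnegative case is applied to the positive and negative parts. Integrability on the [u]
    side makes both integrals finite, so [|a|] distributes over their difference. *)
Lemma Rintegral_affine a b D (f : R -> R) : a != 0 -> measurable D ->
  measurable_fun D f ->
  mu.-integrable ((fun u => a * u + b)%R @^-1` D)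
    (fun u => (f (a * u + b))%:E) ->
  \int[mu]_(t in D) f t =
  `|a| * \int[mu]_(u in (fun u => a * u + b)%R @^-1` D) f (a * u + b).
Proof.
move=> a0 mD mf intf.
have mDf : measurable_fun D (EFin \o f) by exact/measurable_EFinP.
have mphiD : measurable ((fun u => a * u + b) @^-1` D).
  by rewrite -[X in measurable X]setTI; exact: measurable_affine.
have intE : (\int[mu]_(t in D) (f t)%:E = `|a|%:E *
    \int[mu]_(u in (fun u => a * u + b)%R @^-1` D) (f (a * u + b))%:E)%E.
  pose g u := (f (a * u + b))%:E.
  transitivity (`|a|%:E *
      (\int[mu]_(u in (fun u => a * u + b)%R @^-1` D) g^\+ u -
       \int[mu]_(u in (fun u => a * u + b)%R @^-1` D) g^\- u))%E.
    rewrite muleBr//; last first.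
      by apply: fin_num_adde_defr; apply: integrable_fin_num => //;
        exact: integrable_funepos.
    rewrite integralE [X in (X - _)%E](ge0_integral_affine b a0)//; last first.
      exact: measurable_funepos.
    rewrite [X in (_ - X)%E](ge0_integral_affine b a0)//; last first.
      exact: measurable_funeneg.
    by congr (_ * _ - _ * _)%E; apply: eq_integral => u _;
      rewrite ?funeposE ?funenegE.
  by rewrite -integralE.
rewrite /Rintegral intE fineM//; exact: integrable_fin_num.
Qed.

End affine_substitution.

(** * Integrals of powers, with the singularity at 0 *)

Section power_kernel.
Context {R : realType}.
Notation mu := (@lebesgue_measure R).
Implicit Types (s b : R).

Lemma continuous_powR_itv s (p q : R) : 0 < p ->
  {within `[p, q], continuous (fun t : R => t `^ s)}.
Proof.
move=> p0; apply: derivable_within_continuous => t.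
rewrite in_itv/= => /andP[pt _].
by apply: derivable_powR; rewrite in_itv/= andbT (lt_le_trans p0).
Qed.

Lemma measurable_EFin_powR s (D : set R) :
  measurable_fun D (fun t : R => (t `^ s)%:E).
Proof.
by apply/measurable_EFinP; apply: measurable_funTS; exact: measurable_powR.
Qed.

Lemma integral_powR_itv s (p q : R) : s < 1 -> 0 < p -> p < q ->
  (\int[mu]_(t in `[p, q]) (t `^ (- s))%:E =
   ((1 - s)^-1 * q `^ (1 - s))%:E - ((1 - s)^-1 * p `^ (1 - s))%:E)%E.
Proof.
move=> s1 p0 pq.
pose F (t : R) := (1 - s)^-1 * t `^ (1 - s).
have dF (t : R) : 0 < t -> is_derive t 1 F (t `^ (- s)).
  move=> t0; apply: (is_derive_eq (is_deriveZ _ (is_derive1_powR (1 - s) t0))).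
  rewrite /GRing.scale/= mulrA mulVf ?mul1r; last by rewrite gt_eqF// subr_gt0.
  by congr (_ `^ _); ring.
have cF (t : R) : 0 < t ->
    {for t, continuous F}.
  by move=> /dF[/derivable1_diffP/differentiable_continuous].
apply: (@continuous_FTC2 R (fun t => t `^ (- s)) F) => //.
- exact: continuous_powR_itv.
- split.
  + move=> t; rewrite in_itv/= => /andP[pt _].
    by have [] := dF t (lt_trans p0 pt).
  + by apply: cvg_at_right_filter; exact: cF.
  + by apply: cvg_at_left_filter; exact: cF (lt_trans p0 pq).
- move=> t; rewrite in_itv/= => /andP[pt _]; rewrite derive1E.
  by have [_ ->] := dF t (lt_trans p0 pt).
Qed.

(** The intervals [[b / (n + 2), b]] exhaust []0, b]] and avoid the singularity: the fundamental
    theorem of calculus applies on each, and monotone convergence passes to the limit. *)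
Lemma integral_powR_oc s b : s < 1 -> 0 < b ->
  (\int[mu]_(t in `]0%R, b]) (t `^ (- s))%:E =
   ((1 - s)^-1 * b `^ (1 - s))%:E)%E.
Proof.
(* With [n.+2] the left endpoint is strictly below [b] already for [n = 0]. *)
move=> s1 b0; pose F n := `[b / n.+2%:R, b]%classic : set R.
have bn n : 0 < b / n.+2%:R by rewrite divr_gt0.
have -> : `]0%R, b]%classic = \bigcup_n F n.
  apply/seteqP; split=> t /=; last first.
    by move=> [n _]; rewrite /F/= !in_itv/= =>
      /andP[/(lt_le_trans (bn n)) -> ->].
  rewrite in_itv/= => /andP[t0 tb]; exists (Num.truncn (b / t)) => //.
  rewrite /F/= in_itv/= tb andbT ler_pdivrMr// mulrC -ler_pdivrMr//.
  rewrite ltW// (lt_le_trans (truncnS_gt _))// ler_nat.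
  by [].
have cF : (\int[mu]_(t in F n) (t `^ (- s))%:E @[n --> \oo] -->
    \int[mu]_(t in \bigcup_n F n) (t `^ (- s))%:E)%E.
  apply: (@ge0_nondecreasing_set_cvg_integral _ (measurableTypeR R)).
  - apply/nondecreasing_seqP => n; rewrite subsetEset; apply: subset_itvr.
    by rewrite bnd_simp ler_pM2l// lef_pV2 ?posrE// ler_nat.
  - by move=> n; exact: measurable_itv.
  - by move=> n; exact: measurable_EFin_powR.
  - by move=> n x _; rewrite lee_fin powR_ge0.
apply: (cvg_unique _ cF) => //.
have E n : (\int[mu]_(t in F n) (t `^ (- s))%:E =
    ((1 - s)^-1 * b `^ (1 - s) - (1 - s)^-1 * (b / n.+2%:R) `^ (1 - s))%:E)%E.
  by rewrite /F integral_powR_itv// gtr_pMr// invf_lt1// ltr1n.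
rewrite (funext E).
apply: cvg_EFin; first exact: nearW.
rewrite -[X in _ --> X]subr0; apply: cvgB; first exact: cvg_cst.
rewrite -[X in _ --> X](mulr0 (1 - s)^-1); apply: cvgM; first exact: cvg_cst.
have s10 : 0 < 1 - s by rewrite subr_gt0.
(* The power tends to 0 from the right at 0, so it is composed with the positive sequence
   [b / (n + 2)], a multiple of the shifted harmonic one. *)
have /cvg_at_rightP := powR_cvg0 s10; apply; split => //.
rewrite -[X in _ --> X](mulr0 b); apply: cvgM; first exact: cvg_cst.
by have := @cvg_harmonic R; rewrite -cvg_shiftS.
Qed.

End power_kernel.

(** * Positivity and finiteness of Gamma on []0, 1]] *)

Section Gamma_pos.
Context {R : realType}.
Notation mu := (@lebesgue_measure R).

Lemma Gamma_gt0 (z : R) : 0 < z <= 1 -> 0 < Gamma z.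
Proof.
move=> /andP[z0 z1]; pose g t : R := t `^ (z - 1) * expR (- t).
have g0 t : 0 <= g t by rewrite mulr_ge0// ?powR_ge0// expR_ge0.
have mg D : measurable_fun D g.
  apply: measurable_funTS; apply: measurable_funM; first exact: measurable_powR.
  exact: measurableT_comp.
have mG D : measurable_fun D (fun t => (g t)%:E).
  by apply/measurable_EFinP; exact: mg.
have zE : z - 1 = - (1 - z) by ring.
have iG0 : (\int[mu]_(t in `]0%R, 1%R]) (g t)%:E < +oo)%E.
  apply: (@le_lt_trans _ _ (\int[mu]_(t in `]0%R, 1%R]) (t `^ (z - 1))%:E)%E).
    apply: ge0_le_integral => //.
    - by move=> t _; rewrite lee_fin.
    - exact: mG.
    - exact: measurable_EFin_powR.
    - move=> t /=; rewrite in_itv/= => /andP[t0 _].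
      by rewrite lee_fin ler_piMr ?powR_ge0// -expR0 ler_expR oppr_le0 ltW.
  by rewrite zE integral_powR_oc ?ltry// ltrBlDr ltrDl.
have iG1 : (\int[mu]_(t in `]1%R, +oo[) (g t)%:E < +oo)%E.
  (* The density of the exponential law of rate 1 has total mass 1 and equals [expR (- t)] for
     [t >= 0]. *)
  apply: (@le_lt_trans _ _ (\int[mu]_t (exponential_pdf 1 t)%:E)%E); last first.
    by rewrite integral_exponential_pdf// ltry.
  have mexp : measurable_fun [set: R] (fun t => (exponential_pdf (1 : R) t)%:E).
    by apply/measurable_EFinP; exact: measurable_exponential_pdf.
  have exp0 (t : R) : (0 <= (exponential_pdf (1 : R) t)%:E)%E.
    by rewrite lee_fin exponential_pdf_ge0.
  apply: (@le_trans _ _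
    (\int[mu]_(t in `]1%R, +oo[) (exponential_pdf 1 t)%:E)%E).
    apply: ge0_le_integral => //.
    - by move=> t _; rewrite lee_fin.
    - exact: mG.
    - exact: measurable_funTS.
    - move=> t /=; rewrite in_itv/= andbT => t1; have t0 := lt_trans ltr01 t1.
      rewrite lee_fin exponential_pdfE ?(ltW t0)// /g.
      rewrite /= mulN1r mul1r ler_piMl ?expR_ge0//.
      by rewrite -[leRHS](powRr0 t) ler_powR ?(ltW t1)// subr_le0.
  exact: ge0_subset_integral.
have iG : (\int[mu]_(t in `]0%R, +oo[) (g t)%:E =
    \int[mu]_(t in `]0%R, 1%R]) (g t)%:E +
    \int[mu]_(t in `]1%R, +oo[) (g t)%:E)%E.
  rewrite (@itv_bndbnd_setU _ _ _ (BRight 1)) ?bnd_simp//.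
  rewrite ge0_integral_setU//=.
  - exact: mG.
  - by move=> t _; rewrite lee_fin.
  - apply/disj_setPS => t [/=]; rewrite !in_itv/= andbT => /andP[_ t1].
    by rewrite ltNge t1.
have gt0 : (0 < \int[mu]_(t in `]0%R, 1%R]) (g t)%:E)%E.
  apply: (@lt_le_trans _ _ (\int[mu]_(t in `]0%R, 1%R]) (expR (- 1))%:E)%E).
    rewrite integral_cst//= lebesgue_measure_itv/= lte_fin ltr01.
    by rewrite -EFinB subr0 mule1 lte_fin expR_gt0.
  apply: ge0_le_integral => //.
  - exact: mG.
  - move=> t /=; rewrite in_itv/= => /andP[t0 t1]; rewrite lee_fin.
    apply: (@le_trans _ _ (expR (- t))); first by rewrite ler_expR lerN2.
    rewrite ler_peMl ?expR_ge0// -[leLHS](powRr0 t) ger_powR ?t0//.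
    by rewrite subr_le0.
rewrite /Gamma /Rintegral.
rewrite -[X in fine X]/(\int[mu]_(t in `]0%R, +oo[) (g t)%:E)%E iG.
apply: fine_gt0; rewrite lte_add_pinfty// andbT.
apply: (lt_le_trans gt0); rewrite leeDl// integral_ge0// => t _.
by rewrite lee_fin.
Qed.

End Gamma_pos.

Section jacobi_kernel.
Context {R : realType}.
Notation mu := (@lebesgue_measure R).
Implicit Types (s : R) (h : R -> R).

Lemma measurable_jacobi s (D : set R) :
  measurable_fun D (fun u : R => (1 - u) `^ (- s)).
Proof.
apply: measurable_funTS.
apply: (@measurableT_comp _ _ _ _ _ _ (fun t : R => t `^ (- s))).
  exact: measurable_powR.
exact: measurable_funB.
Qed.

(** The reflection [t = 1 - u] carries [[-1, 1]] onto [[0, 2]], which differs from []0, 2]] by a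
    null set. *)
Lemma integral_jacobi s : s < 1 ->
  (\int[mu]_(u in `[(-1)%R, 1%R]) ((1 - u) `^ (- s))%:E =
   ((1 - s)^-1 * 2 `^ (1 - s))%:E)%E.
Proof.
move=> s1; rewrite -integral_powR_oc// integral_itv_obnd_cbnd; last first.
  exact: measurable_EFin_powR.
rewrite [RHS](@ge0_integral_affine _ (-1) 1)//; last 2 first.
- exact: measurable_EFin_powR.
- by move=> t _; rewrite lee_fin powR_ge0.
rewrite normrN1 mul1e.
rewrite (_ : _ @^-1` _ = `[(-1)%R, 1%R]%classic).
  by apply: eq_integral => u _; rewrite mulN1r addrC.
apply/seteqP; split=> u /=; rewrite !in_itv/= => /andP[? ?].
  by apply/andP; split; lra.
by apply/andP; split; lra.
Qed.

Lemma Rintegral_jacobi s : s < 1 ->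
  \int[mu]_(u in `[(-1)%R, 1%R]) (1 - u) `^ (- s) = (1 - s)^-1 * 2 `^ (1 - s).
Proof. by move=> s1; rewrite /Rintegral integral_jacobi. Qed.

(** On the compact interval [|h|] attains a maximum, and that constant times the weight dominates
    the product. *)
Lemma integrable_jacobi s h : s < 1 -> continuous h ->
  mu.-integrable `[(-1)%R, 1%R] (fun u => (h u * (1 - u) `^ (- s))%:E).
Proof.
move=> s1 ch.
have mh : measurable_fun (`[(-1)%R, 1%R]%classic : set R) h.
  by apply: measurable_funTS; exact: continuous_measurable_fun.
have I0 : (`[(-1)%R, 1%R]%classic : set R) !=set0.
  by exists 0; rewrite /= in_itv/=; apply/andP; split; lra.
have chI : {within `[(-1)%R, 1%R], continuous (fun u => `|h u|)}.
  apply: continuous_subspaceT => u; apply: (continuous_comp (ch u)).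
  exact: norm_continuous.
have [c _ hc] := compact_EVT_max I0 (@segment_compact _ _ _) chI.
apply: (@le_integrable _ _ _ mu _ _ _
  (fun u => `|h c|%:E * ((1 - u) `^ (- s))%:E)%E) => //.
- apply/measurable_EFinP; apply: measurable_funM => //; exact: measurable_jacobi.
- move=> u uI; rewrite -EFinM !abse_EFin lee_fin !normrM normr_id.
  by rewrite ler_wpM2r// hc// inE.
- apply: integrableZl => //; apply/integrableP; split.
    by apply/measurable_EFinP; exact: measurable_jacobi.
  under eq_integral do rewrite gee0_abs ?lee_fin ?powR_ge0//.
  by rewrite integral_jacobi// ltry.
Qed.

End jacobi_kernel.

(** * Caputo derivatives as integrals over [[-1, 1]] *)

Section caputo_formula.
Context {R : realType}.
Notation mu := (@lebesgue_measure R).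
Implicit Types (s nu a c x : R) (g h : R -> R).

Lemma Rintegral_abel_kernel s a c h (D : set R) : s < 1 -> a != 0 ->
  measurable D -> (fun u => a * u + (a + c)) @^-1` D = `[(-1)%R, 1%R]%classic ->
  continuous h ->
  \int[mu]_(t in D) (h t / `|c + 2 * a - t| `^ s) =
  `|a| `^ (1 - s) *
  \int[mu]_(u in `[(-1)%R, 1%R]) (h (a * (1 + u) + c) * (1 - u) `^ (- s)).
Proof.
move=> s1 a0 mD Dphi ch.
pose F t := h t / `|c + 2 * a - t| `^ s.
pose G u := h (a * (1 + u) + c) * (1 - u) `^ (- s).
have FG u : u \in `[(-1)%R, 1%R]%classic ->
    F (a * u + (a + c)) = `|a| `^ (- s) * G u.
  rewrite inE/= in_itv/= => /andP[_ u1]; rewrite /F /G.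
  rewrite (_ : c + 2 * a - (a * u + (a + c)) = a * (1 - u)); last by ring.
  rewrite normrM (ger0_norm (_ : 0 <= 1 - u)) ?subr_ge0// -powRN.
  rewrite powRM// ?subr_ge0// mulrCA; congr (_ * (h _ * _)); ring.
have iG : mu.-integrable `[(-1)%R, 1%R] (fun u => (G u)%:E).
  apply: (@integrable_jacobi _ s (fun u => h (a * (1 + u) + c))) => // u.
  rewrite (_ : (fun u => _) = h \o (fun u => a * u + (a + c))); last first.
    by apply/funext => v /=; congr h; ring.
  by apply: (@continuous_comp R R R); [exact: continuous_affine|exact: ch].
have iF : mu.-integrable `[(-1)%R, 1%R] (fun u => (F (a * u + (a + c)))%:E).
  apply: (@eq_integrable _ _ _ mu _ _
    (fun u => (`|a| `^ (- s))%:E * (G u)%:E)%E) => //.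
    by move=> u uI; rewrite -EFinM FG.
  exact: integrableZl.
rewrite (@Rintegral_affine _ a (a + c)) ?Dphi//; last first.
  apply: measurable_funM.
    by apply: measurable_funTS; exact: continuous_measurable_fun.
  under eq_fun do rewrite -powRN.
  apply: measurable_funTS.
  apply: (@measurableT_comp _ _ _ _ _ _ (fun t : R => t `^ (- s))).
    exact: measurable_powR.
  by apply: measurableT_comp => //; exact: measurable_funB.
rewrite -[X in _ * X]/(\int[mu]_(u in `[(-1)%R, 1%R]) F (a * u + (a + c))).
have -> : \int[mu]_(u in `[(-1)%R, 1%R]) F (a * u + (a + c)) =
    \int[mu]_(u in `[(-1)%R, 1%R]) (`|a| `^ (- s) * G u).
  exact: eq_Rintegral.
rewrite RintegralZl// mulrA; congr (_ * _).
by rewrite powRD ?powRr1// normr_eq0 a0 implybT.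
Qed.

Lemma caputoE nu n c g x : caputo_order nu = n -> x != c ->
  continuous (derive1n n g) ->
  let s := nu - n%:R + 1 in let a := (x - c) / 2 in
  caputo nu c g x = (if c <= x then 1 else (-1) ^+ n) / Gamma (n%:R - nu) *
    (`|a| `^ (1 - s) * \int[mu]_(u in `[(-1)%R, 1%R])
       (derive1n n g (a * (1 + u) + c) * (1 - u) `^ (- s))).
Proof.
move=> nuE xc cg s a.
have nun : nu < n%:R by rewrite -nuE /caputo_order truncnS_gt.
have s1 : s < 1 by rewrite /s gtrDr subr_lt0.
have a0 : a != 0 by rewrite mulf_neq0 ?subr_eq0// invr_neq0.
have xE : c + 2 * a = x by rewrite /a; field.
rewrite /caputo nuE; case: ifPn => [cx|]; [rewrite div1r|rewrite -ltNge => xltc];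
  congr (_ * _).
- have ap : 0 < a by rewrite divr_gt0// subr_gt0 lt_neqAle eq_sym xc.
  have phiD : (fun u => a * u + (a + c)) @^-1` `[c, x] = `[(-1)%R, 1%R]%classic.
    apply/seteqP; split=> u /=; rewrite !in_itv/= -xE => /andP[u1 u2].
      (* Multiplying the bounds on [u] by [a] makes the problem linear in the product [a * u]. *)
      by apply/andP; split; rewrite -(ler_pM2l ap); lra.
    move: u1 u2; rewrite -(ler_pM2l ap (-1)) -(ler_pM2l ap u) => u1 u2.
    by apply/andP; split; lra.
  rewrite -(Rintegral_abel_kernel s1 a0 (measurable_itv _) phiD cg).
  apply: eq_Rintegral => t; rewrite inE/= in_itv/= => /andP[_ tx].
  by rewrite xE ger0_norm ?subr_ge0.
- have ap : a < 0 by rewrite pmulr_llt0 ?invr_gt0// subr_lt0.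
  have phiD : (fun u => a * u + (a + c)) @^-1` `[x, c] = `[(-1)%R, 1%R]%classic.
    apply/seteqP; split=> u /=; rewrite !in_itv/= -xE => /andP[u1 u2].
      by apply/andP; split; rewrite -(ler_nM2l ap); lra.
    move: u1 u2; rewrite -(ler_nM2l ap u) -(ler_nM2l ap 1) => u1 u2.
    by apply/andP; split; lra.
  rewrite -(Rintegral_abel_kernel s1 a0 (measurable_itv _) phiD cg).
  apply: eq_Rintegral => t; rewrite inE/= in_itv/= => /andP[xt _].
  by rewrite xE distrC ger0_norm ?subr_ge0.
Qed.

End caputo_formula.

(** * Derivatives of one-variable slices *)

Section slices.
Context {R : realType} {d : nat}.
Implicit Types (f : 'cV[R]_d -> R) (x : 'cV[R]_d) (j : 'I_d).

(** Moving [y] by [h] moves the point by [h] times the basis vector, so the two difference quotients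
    coincide. As an equality of functions, it can be iterated for the second derivative. *)
Lemma derive1_slice f x j :
  derive1 (slice f x j) = slice (fun y => 'D_(std_basis R j) f y) x j.
Proof.
apply/funext => y; rewrite /derive1 /slice /derive.
set F := fun h => _; set G := fun h => _.
suff -> : F = G by [].
apply/funext => h; rewrite /F /G/=; congr (_ *: (f _ - _)).
by rewrite addrCA -scalerDl; congr (_ + _ *: _); ring.
Qed.

Lemma continuous_slice f x j : continuous f -> continuous (slice f x j).
Proof.
move=> cf y; apply: (@continuous_comp R 'cV[R]_d R
  (fun y => x + (y - x j ord0) *: std_basis R j) f).
  apply: (@continuousD R 'cV[R]_d R); first exact: cst_continuous.
  apply: (@continuousZr_tmp R 'cV[R]_d R).
  by apply: continuousB => //; exact: cst_continuous.
exact: cf.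
Qed.

End slices.

(** * Components of the direction and the orders [alpha] and [1 + alpha] *)

Section direction.
Context {R : realType} {d : nat}.
Notation mu := (@lebesgue_measure R).

Lemma scaled_caputo_directionE (alpha beta : R) (c : 'cV[R]_d)
    (f : 'cV[R]_d -> R) (x : 'cV[R]_d) (j : 'I_d) :
  (forall i, caputo alpha (c i ord0) (@id R) (x i ord0) != 0) ->
  scaled_caputo_direction alpha beta c f x j ord0 =
  (caputo alpha (c j ord0) (@id R) (x j ord0))^-1 *
  (caputo alpha (c j ord0) (slice f x j) (x j ord0) +
   beta * `|x j ord0 - c j ord0| *
     caputo (1 + alpha) (c j ord0) (slice f x j) (x j ord0)).
Proof.
move=> id0.
pose v : 'rV[R]_d := \row_i caputo alpha (c i ord0) (@id R) (x i ord0).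
(* All diagonal entries must be nonzero here, even to read off a single component. *)
have invE : invmx (diag_mx v) = diag_mx (\row_i (v ord0 i)^-1).
  have vK : diag_mx v *m diag_mx (\row_i (v ord0 i)^-1) = 1%:M.
    rewrite mulmx_diag; apply/matrixP => i k; rewrite !mxE.
    by rewrite divff// mxE.
  by rewrite -[LHS]mulmx1 -vK mulKmx//; case/mulmx1_unit: vK.
have gE nu : caputo_gradient nu c f x j ord0 =
    caputo nu (c j ord0) (slice f x j) (x j ord0) by rewrite mxE.
rewrite /scaled_caputo_direction -/v invE -!gE.
(* Generalizing the gradients keeps [mxE] from unfolding their entries. *)
move: (caputo_gradient alpha c f x) (caputo_gradient (1 + alpha) c f x).
move=> g1 g2.
by rewrite !mul_diag_mx !mxE mulrA.
Qed.


Lemma caputo_order_lt1 (nu : R) : 0 < nu < 1 -> caputo_order nu = 1%N.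
Proof.
move=> /andP[n0 n1]; have H : 0%:R <= nu < 1%:R by rewrite (ltW n0) n1.
by rewrite /caputo_order (truncn_def H).
Qed.
Lemma caputo_order_lt2 (nu : R) : 0 < nu < 1 -> caputo_order (1 + nu) = 2%N.
Proof.
move=> /andP[n0 n1]; have H : 1%:R <= 1 + nu < 2%:R by apply/andP; split; lra.
by rewrite /caputo_order (truncn_def H).
Qed.

Lemma caputo_lt1E (alpha c x : R) (g : R -> R) : 0 < alpha < 1 -> x != c ->
  continuous (derive1n 1 g) ->
  caputo alpha c g x = (if c <= x then 1 else - 1) / Gamma (1 - alpha) *
    (`|(x - c) / 2| `^ (1 - alpha) * \int[mu]_(u in `[(-1)%R, 1%R])
       (derive1n 1 g ((x - c) / 2 * (1 + u) + c) * (1 - u) `^ (- alpha))).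
Proof.
move=> a01 xc cg; rewrite (caputoE (caputo_order_lt1 a01) xc cg).
by rewrite subrK expr1.
Qed.

(** Since [n = 2], the sign of the right derivative is 1 and the two cases merge; the kernel
    exponent is again [alpha]. *)
Lemma caputo_lt2E (alpha c x : R) (g : R -> R) : 0 < alpha < 1 -> x != c ->
  continuous (derive1n 2 g) ->
  caputo (1 + alpha) c g x = (Gamma (1 - alpha))^-1 *
    (`|(x - c) / 2| `^ (1 - alpha) * \int[mu]_(u in `[(-1)%R, 1%R])
       (derive1n 2 g ((x - c) / 2 * (1 + u) + c) * (1 - u) `^ (- alpha))).
Proof.
move=> a01 xc cg; rewrite (caputoE (caputo_order_lt2 a01) xc cg).
rewrite (_ : 1 + alpha - 2 + 1 = alpha); last by ring.
rewrite (_ : 2 - (1 + alpha) = 1 - alpha); last by ring.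
by rewrite sqrrN expr1n if_same div1r.
Qed.

Lemma caputo_id (alpha c x : R) : 0 < alpha < 1 -> x != c ->
  caputo alpha c (@id R) x = (if c <= x then 1 else - 1) / Gamma (1 - alpha) *
    (`|(x - c) / 2| `^ (1 - alpha) * (Ccoef alpha)^-1).
Proof.
move=> a01 xc; have d1 : derive1n 1 (@id R) = cst 1.
  by apply/funext => y; rewrite /= derive1E derive_id.
rewrite caputo_lt1E// d1; last by move=> y; exact: cst_continuous.
congr (_ * (_ * _)); under eq_Rintegral do rewrite mul1r.
have /andP[_ a1] := a01.
by rewrite Rintegral_jacobi// /Ccoef invfM powRN invrK.
Qed.

End direction.

(* For x j < c j the node c j + Delta (1 + u) of the case c j < x j becomes
   c j - Delta (1 + u), so that it runs over [x j, c j], and the second-order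
   term changes sign, since the factor (-1) ^+ n of the right Caputo derivative
   is -1 for the orders alpha and 1 for the order 1 + alpha. *)
Theorem theorem2p4 (R : realType) (d : nat) (f : 'cV[R]_d -> R)
    (hf : Ck 2 f) (alpha beta : R) (halpha : 0 < alpha < 1)
    (x c : 'cV[R]_d) (hxc : forall j : 'I_d, x j ord0 != c j ord0)
    (j : 'I_d) :
  let fj := slice f x j in
  let xj := x j ord0 in
  let cj := c j ord0 in
  let Delta := `|xj - cj| / 2 in
  let dk := scaled_caputo_direction alpha beta c f x in
  (cj < xj ->
    dk j ord0 =
      Ccoef alpha *
        \int[lebesgue_measure]_(u in `[(-1)%R, 1%R])
          (derive1n 1 fj (Delta * (1 + u) + cj) * (1 - u) `^ (- alpha))
      + Ccoef alpha * beta * `|xj - cj| *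
        \int[lebesgue_measure]_(u in `[(-1)%R, 1%R])
          (derive1n 2 fj (Delta * (1 + u) + cj) * (1 - u) `^ (- alpha))) /\
  (xj < cj ->
    dk j ord0 =
      Ccoef alpha *
        \int[lebesgue_measure]_(u in `[(-1)%R, 1%R])
          (derive1n 1 fj (- Delta * (1 + u) + cj) * (1 - u) `^ (- alpha))
      - Ccoef alpha * beta * `|xj - cj| *
        \int[lebesgue_measure]_(u in `[(-1)%R, 1%R])
          (derive1n 2 fj (- Delta * (1 + u) + cj) * (1 - u) `^ (- alpha))).
Proof.
move=> fj xj cj Delta dk; have [_ _ dcont] := hf.
have c1 : continuous (derive1n 1 fj).
  rewrite /= derive1_slice; apply: continuous_slice.
  by have [] := dcont j.
have c2 : continuous (derive1n 2 fj).
  rewrite /= !derive1_slice; apply: continuous_slice.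
  by have [_ _ /(_ j)] := dcont j.
have G0 : Gamma (1 - alpha) != 0.
  have /andP[a0 a1] := halpha; rewrite gt_eqF// Gamma_gt0//.
  by rewrite subr_gt0 a1 gerBl ltW.
have C0 : Ccoef alpha != 0.
  have /andP[_ a1] := halpha; rewrite gt_eqF// /Ccoef.
  by rewrite mulr_gt0 ?subr_gt0// powR_gt0.
have P0 i : `|(x i ord0 - c i ord0) / 2| `^ (1 - alpha) != 0.
  by rewrite gt_eqF// powR_gt0// normr_gt0 mulf_neq0// subr_eq0.
have id0 i : caputo alpha (c i ord0) (@id R) (x i ord0) != 0.
  rewrite caputo_id// !mulf_neq0 ?invr_neq0//.
  by case: ifP; rewrite ?oppr_eq0 oner_eq0.
have Pj : `|(xj - cj) / 2| `^ (1 - alpha) != 0 := P0 j.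
rewrite /dk scaled_caputo_directionE// caputo_id//.
rewrite (caputo_lt1E halpha (hxc j) c1) (caputo_lt2E halpha (hxc j) c2) -/xj -/cj.
(* This power and the Gamma factor occur in all three Caputo derivatives and cancel in the
   quotient. *)
set s := `|(xj - cj) / 2| `^ _ in Pj *.
split=> ltc; [rewrite (ltW ltc)|rewrite leNgt ltc/=].
- have -> : Delta = (xj - cj) / 2 by rewrite /Delta ger0_norm// subr_ge0 ltW.
  move: (Rintegral _ _ _) (Rintegral _ _ _) => I1 I2.
  by field; rewrite G0 C0 Pj.
(* The derivatives of order [alpha] of the slice and of the identity both carry the sign -1, which
   cancels; the second-order term has no such sign and so ends up negated. *)
- have -> : - Delta = (xj - cj) / 2.
    by rewrite /Delta ltr0_norm ?subr_lt0// mulNr opprK.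
  move: (Rintegral _ _ _) (Rintegral _ _ _) => I1 I2.
  by field; rewrite G0 C0 Pj.
Qed.
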